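(* Let $N\ge3$, $\beta>-2$, $p_\beta^*=\frac{N+\beta}{N-2}$, and let $\Omega=\mathbb{R}^N\setminus\mathcal{O}$ be a punctured or exterior domain with $\mathbb{R}^N\setminus B_e(0)\subset\Omega$. Let $h$ be a measurable function with $$h(x,u)=|x|^\beta(\ln|x|)^\tau u^p,\quad x\in\mathbb{R}^N\setminus B_e(0).$$ Consider the problem $$-\Delta u=h(x,u)\ \text{ in }\Omega,\qquad u\ge0\ \text{ on }\partial\Omega.$$ Then: (i) the problem has no positive supersolution provided that either $1\le p<p_\beta^*$ and $\tau\in\mathbb{R}$, or $p=p_\beta^*$ and $\tau>-1$; (ii) the problem has no positive bounded supersolution provided that $p\in(-\infty,1)$ and $\tau\in\mathbb{R}$.
   Context: $B_r(0)$ is the ball of radius $r$ centered at the origin ($e$ is Euler's number). A punctured or exterior domain is a set $\Omega=\mathbb{R}^N\setminus\mathcal{O}$ where $\mathcal{O}$ is a bounded, closed, smooth subset of $\mathbb{R}^N$; typical examples are $\mathbb{R}^N\setminus\{0\}$ and $\mathbb{R}^N\setminus\overline{B}_R(0)$. A function $u\in C^2(\Omega)$ is a positive supersolution of the problem if $u(x)>0$ and $-\Delta u(x)\ge h(x,u(x))$ for all $x\in\Omega$; it is a positive bounded supersolution if moreover $u$ is bounded in $\Omega$. *)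

(* Defs.v *)
From HB Require Import structures.
From mathcomp Require Import all_boot all_order all_algebra.
From mathcomp Require Import all_classical all_reals all_analysis.

Set Implicit Arguments.
Unset Strict Implicit.
Unset Printing Implicit Defensive.

Import Order.TTheory GRing.Theory Num.Theory.
Import numFieldNormedType.Exports.

Local Open Scope classical_set_scope.
Local Open Scope ring_scope.

(* The library norm `|x| on 'rV[R]_n is the sup norm; it induces the usual
   topology and the usual bounded sets, but not the usual balls. *)
Definition enorm (R : realType) (n : nat) (x : 'rV[R]_n) : R :=
  Num.sqrt (\sum_(i < n) x 0 i ^+ 2).

Definition eball0 (R : realType) (n : nat) (r : R) : set 'rV[R]_n :=
  [set x | enorm x < r].

Definition partial (R : realType) (n : nat) (i : 'I_n) (f : 'rV[R]_n -> R)
  : 'rV[R]_n -> R := fun x => 'D_(delta_mx 0 i) f x.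

(* f is of class C^k on U.  Meaningful for U open: only the values of f on U
   then matter, so a function on U is represented by any total extension. *)
Fixpoint Ck (R : realType) (n k : nat) (U : set 'rV[R]_n)
    (f : 'rV[R]_n -> R) : Prop :=
  (forall x, U x -> {for x, continuous f}) /\
  if k is k'.+1 then
    forall i : 'I_n, (forall x, U x -> derivable f x (delta_mx 0 i)) /\
                     Ck k' U (partial i f)
  else True.

Definition Cinfty (R : realType) (n : nat) (U : set 'rV[R]_n)
  (f : 'rV[R]_n -> R) : Prop := forall k, Ck k U f.

Definition laplacian (R : realType) (n : nat) (f : 'rV[R]_n -> R)
  : 'rV[R]_n -> R := fun x => \sum_(i < n) partial i (partial i f) x.

(* K is an embedded smooth submanifold, possibly with boundary, whose
   components may have any dimension from 0 to n: near each of its points K is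
   cut out by smooth functions g i with independent gradients, through the
   equations g i = 0, except possibly for one index b, for which the constraint
   is g b <= 0.  This covers points (n equations), closed balls (a single
   inequality) and finite disjoint unions of such sets. *)
Definition smooth_subset (R : realType) (n : nat) (K : set 'rV[R]_n) : Prop :=
  forall x, K x ->
  exists (U : set 'rV[R]_n) (m : nat) (g : 'I_m -> 'rV[R]_n -> R)
         (b : option 'I_m),
    [/\ open_nbhs x U,
        (forall i, Cinfty U (g i)),
        row_free (\matrix_(i < m, j < n) partial j (g i) x) &
        forall y, U y ->
          (K y <-> forall i, if b == Some i then is_true (g i y <= 0)
                              else g i y = 0)].

Definition punctured_or_exterior (R : realType) (n : nat)
    (Omega : set 'rV[R]_n) : Prop :=
  exists K : set 'rV[R]_n,
    [/\ bounded_set K, closed K, smooth_subset K & Omega = ~` K].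

Definition lebesgue_null (R : realType) (n : nat) (A : set 'rV[R]_n) : Prop :=
  forall eps : R, 0 < eps ->
  exists a b : nat -> 'rV[R]_n,
    [/\ (forall k i, a k 0 i <= b k 0 i),
        A `<=` \bigcup_k [set x | forall i, a k 0 i <= x 0 i <= b k 0 i] &
        (\sum_(0 <= k <oo) (\prod_(i < n) (b k 0 i - a k 0 i))%:E <= eps%:E)%E].

Definition lebesgue_measurable (R : realType) (n : nat) (A : set 'rV[R]_n)
  : Prop :=
  exists B : set 'rV[R]_n,
    <<s [set U : set 'rV[R]_n | open U] >> B /\
    lebesgue_null ((A `\` B) `|` (B `\` A)).

(* Lebesgue measurability of (x, s) |-> h x s on Omega * ]0, +oo[, where
   R^n * R is identified with R^(n+1); h is only evaluated at s = u x > 0. *)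
Definition measurable_nonlinearity (R : realType) (n : nat)
    (Omega : set 'rV[R]_n) (h : 'rV[R]_n -> R -> R) : Prop :=
  forall B : set R, measurable B ->
    lebesgue_measurable
      [set z : 'rV[R]_(n + 1) | [/\ Omega (lsubmx z), 0 < rsubmx z 0 0 &
                                    B (h (lsubmx z) (rsubmx z 0 0))]].

Definition positive_supersolution (R : realType) (n : nat)
    (Omega : set 'rV[R]_n) (h : 'rV[R]_n -> R -> R) (u : 'rV[R]_n -> R) : Prop :=
  Ck 2 Omega u /\
  forall x, Omega x -> 0 < u x /\ h x (u x) <= - laplacian u x.

Definition positive_bounded_supersolution (R : realType) (n : nat)
    (Omega : set 'rV[R]_n) (h : 'rV[R]_n -> R -> R) (u : 'rV[R]_n -> R) : Prop :=
  positive_supersolution Omega h u /\ [bounded u x | x in Omega].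

Definition pstar (R : realType) (n : nat) (beta : R) : R :=
  (n%:R + beta) / (n%:R - 2).

(* Main.v *)
Require Import Defs.
From HB Require Import structures.
From mathcomp Require Import all_boot all_order all_algebra.
From mathcomp Require Import all_classical all_reals all_analysis.
From mathcomp Require Import ring lra.

Import Order.TTheory GRing.Theory Num.Theory.
Import numFieldNormedType.Exports.

Local Open Scope classical_set_scope.
Local Open Scope ring_scope.

Set Implicit Arguments.
Unset Strict Implicit.
Unset Printing Implicit Defensive.

(** The proof replaces spherical means by spherical minima, so that it needs
only the maximum principle and no integration over spheres.  Write s = |x|^2,
nu = (N - 2)/2, so that s^(-nu) is the fundamental solution, and let m(t) be
the minimum of the supersolution u on the sphere s = t, with a(t) = t^nu m(t).
Comparing u with explicit radial functions gives three facts about a positive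
strictly superharmonic function outside a ball.

- u >= a(t) s^(-nu) wherever s >= t (fundamental_lower_bound): subtract from
  the right-hand side its value on a sphere of radius tending to infinity.
- m(4t) <= 5 m(t), hence a(4t) <= C a(t) (min_doubling): the barrier is affine
  in s.
- If -Laplacian u >= V u on t <= s <= 16t, with V a constant, then
  a(4t) >= a(t) (1 + c t V) (annulus_gain): add to a(t) s^(-nu) a multiple of
  (s - t)(16t - s).

The last two facts bound t V.  For the linear inequality
-Laplacian u >= kappa s^theta u with theta > -1 one has t V ~ t^(theta + 1),
which is unbounded: contradiction (no_linear_supersolution).  This settles
p = 1, where the logarithm is absorbed by lowering beta slightly, and p < 1
with u <= M, because then u^p >= M^(p-1) u.

For p > 1 it is enough to treat the weight s^(nu (p-1) - 1) / ln s: when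
p < pstar a power is left over to absorb the logarithm, and when p = pstar and
tau > -1 one uses (ln r)^tau >= 1 / ln r.  Along t_k = 4^k t_0 the gain reads
a_(k+1) >= a_k + c a_k^p / (k+1), while a_(k+1) <= C a_k.  This is a discrete
form of y' = c y^p / k: the quantity a_k^(1-p) is positive and loses at least
c' / (k+1) at each step, against the divergence of the harmonic series
(harmonic_growth_absurd). *)

(** * The maximum principle for radial comparison functions *)

(** The function d stands for g'.  If c were negative, g' would be negative just
to the right of 0 and g would drop below g 0 by the mean value theorem. *)
Lemma second_derivative_ge0 (R : realType) (g d : R -> R) (c e : R) :
  0 < e -> (forall h : R, `|h| < e -> is_derive h 1 g (d h)) ->
  is_derive (0 : R) (1 : R) d c ->
  (forall h, `|h| < e -> g 0 <= g h) -> 0 <= c.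
Proof.
move=> e0 dg [dd dc] gmin.
have ine h : h \in `]- e, e[%R -> `|h| < e by rewrite in_itv/= ltr_norml.
have [_ d0] : is_derive (0 : R) 1 g 0.
  apply: (@derive1_at_min _ g (- e) e 0) => //; first lra.
  - by move=> t /ine te; have [] := dg t te.
  - by rewrite in_itv/=; apply/andP; split; lra.
  - by move=> t /ine; exact: gmin.
have {}d0 : d 0 = 0.
  by have [_ <-] : is_derive (0 : R) 1 g (d 0) by apply: dg; rewrite normr0.
rewrite leNgt; apply/negP => c0.
have : (fun h : R => h^-1 *: ((d \o shift 0) (h *: 1) - d 0)) @ 0^' --> c.
  by rewrite -dc; exact: dd.
move=> /(_ _ (lt_nbhsl c0)).
move=> [r /= r0 rP].
pose h := Num.min r e / 2.
have m0 : 0 < Num.min r e by rewrite lt_min r0.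
have mr : Num.min r e <= r by rewrite ge_min lexx.
have me : Num.min r e <= e by rewrite ge_min lexx orbT.
have h0 : 0 < h by rewrite /h; lra.
have he : h < e by rewrite /h; lra.
have hr : h < r by rewrite /h; lra.
have inh x : 0 < x -> x <= h -> `|x| < e.
  by move=> x0 xh; rewrite gtr0_norm// (le_lt_trans xh).
have [||x xh gx] := @MVT _ g d 0 h h0.
- by move=> x; rewrite in_itv/= => /andP[x0 xh]; apply: dg; apply: inh => //; exact: ltW.
- apply: continuous_in_subspaceT => x; rewrite inE/= in_itv/= => /andP[x0 xh].
  have xe : `|x| < e by rewrite ger0_norm// (le_lt_trans xh).
  have [dgx _] := dg x xe.
  by apply: differentiable_continuous; apply/derivable1_diffP.
move: xh; rewrite in_itv/= => /andP[x0 xh].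
have := rP x; rewrite /= d0 subr0 addr0 sub0r normrN (gtr0_norm x0).
move=> /(_ (lt_trans xh hr)); rewrite gt_eqF// => /(_ isT).
rewrite /GRing.scale/= mulr1 => qx.
have dx : d x < 0.
  by move: qx; rewrite pmulr_rlt0// invr_gt0.
have := gmin h (inh _ h0 (lexx _)).
rewrite -subr_ge0 gx subr0.
by rewrite leNgt nmulr_rlt0// h0.
Qed.

(** Radial functions are written as functions of the squared norm: along a
coordinate line it is a quadratic polynomial, so their derivatives need only
the one-variable chain rule. *)
Definition sqnorm (R : realType) (n : nat) (x : 'rV[R]_n) : R :=
  \sum_(i < n) x 0 i ^+ 2.

Lemma sqnorm_line (R : realType) (n : nat) (x : 'rV[R]_n) (i : 'I_n) (h : R) :
  sqnorm (h *: delta_mx 0 i + x) = sqnorm x + 2 * h * x 0 i + h ^+ 2.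
Proof.
rewrite /sqnorm (bigD1 i)//= [in RHS](bigD1 i)//= !mxE !eqxx/= mulr1.
rewrite (eq_bigr (fun j => x 0 j ^+ 2)).
  by ring.
by move=> j ji; rewrite !mxE eqxx (negbTE ji)/= mulr0 add0r.
Qed.

Lemma continuous_sqnorm (R : realType) (n : nat) : continuous (@sqnorm R n).
Proof.
apply: (@continuous_big _ 'I_n (@GRing.add R) 0 xpredT _ 'rV[R]_n
  (index_enum 'I_n) (fun i (y : 'rV[R]_n) => y 0 i ^+ 2)).
  exact: add_continuous.
move=> i _ x; apply: (@continuous_comp _ _ _ (fun y : 'rV[R]_n => y 0 i)
  (fun y : R => y ^+ 2)).
  exact: coord_continuous.
exact: exprn_continuous.
Qed.

Lemma compact_annulus (R : realType) (n : nat) (t t' : R) :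
  compact [set x : 'rV[R]_n | t <= sqnorm x <= t'].
Proof.
apply: bounded_closed_compact.
  exists (Num.sqrt t'); split; first by rewrite num_real.
  move=> M M0 x /= /andP[_ xt'].
  have M1 : 0 <= M by rewrite (le_trans _ (ltW M0))// sqrtr_ge0.
  rewrite [leLHS]/Num.norm /= mx_normrE; apply/bigmax_leP; split=> //= -[j i] _ /=.
  rewrite (ord1 j) (le_trans _ (ltW M0))// -sqrtr_sqr ler_sqrt; last first.
    by rewrite (le_trans _ xt')// sumr_ge0// => k _; exact: sqr_ge0.
  apply: le_trans xt'; rewrite /sqnorm (bigD1 i)//= lerDl.
  by apply: sumr_ge0 => k _; exact: sqr_ge0.
have -> : [set x : 'rV[R]_n | t <= sqnorm x <= t'] =
    @sqnorm R n @^-1` [set s | t <= s] `&` @sqnorm R n @^-1` [set s | s <= t'].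
  by apply/seteqP; split=> x /=; [move=> /andP[]|move=> [-> ->]].
apply: closedI; apply: preimage_closed; try exact: closed_ge; try exact: closed_le.
all: by move=> x _; exact: continuous_sqnorm.
Qed.

(** The part of C^2 regularity that the second derivative test along the
coordinate axes uses. *)
Definition C2_at (R : realType) (n : nat) (u : 'rV[R]_n -> R) (x : 'rV[R]_n) :=
  {for x, continuous u} /\ forall i,
    derivable u x (delta_mx 0 i) /\ derivable (partial i u) x (delta_mx 0 i).

Lemma is_derive_line (R : realType) (n : nat) (f : 'rV[R]_n -> R)
    (x v : 'rV[R]_n) (h : R) :
  derivable f (h *: v + x) v ->
  is_derive h 1 (fun k => f (k *: v + x)) ('D_v f (h *: v + x)).
Proof.
have E : (fun k : R => k^-1 *:
    (((fun k => f (k *: v + x)) \o shift h) (k *: 1) - f (h *: v + x)))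
  = (fun k : R => k^-1 *: ((f \o shift (h *: v + x)) (k *: v) - f (h *: v + x))).
  apply/funext => k /=; congr (_ *: (f _ - _)).
  have -> : k *: (1 : R) = k by exact: mulr1.
  by rewrite scalerDl addrA.
by move=> df; split; [rewrite /derivable E|rewrite /derive E].
Qed.

(** The difference u - phi(|.|^2) attains its minimum over the closed annulus.
At an interior minimum every pure second derivative is nonnegative, hence so is
the Laplacian, which contradicts the strict inequality assumed there: the
right-hand side is the Laplacian of phi(|x|^2). *)
Lemma radial_comparison (R : realType) (n : nat) (u : 'rV[R]_n -> R)
    (phi phi1 phi2 : R -> R) (t t' : R) :
  (forall s : R, t <= s <= t' -> is_derive s 1 phi (phi1 s)) ->
  (forall s : R, t <= s <= t' -> is_derive s 1 phi1 (phi2 s)) ->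
  (forall x, t <= sqnorm x <= t' -> C2_at u x) ->
  (forall x, t < sqnorm x < t' ->
     laplacian u x < 4 * sqnorm x * phi2 (sqnorm x) + 2 * n%:R * phi1 (sqnorm x)) ->
  (forall x, sqnorm x = t \/ sqnorm x = t' -> phi (sqnorm x) <= u x) ->
  forall x, t <= sqnorm x <= t' -> phi (sqnorm x) <= u x.
Proof.
move=> dphi dphi1 u2 lap bd x xtt'.
pose A := [set x : 'rV[R]_n | t <= sqnorm x <= t'].
have Ax : A x by [].
pose w y := u y - phi (sqnorm y).
have cw : {within A, continuous w}.
  apply: continuous_in_subspaceT => y; rewrite inE => Ay.
  have [uy _] := u2 y Ay.
  have cphi : {for sqnorm y, continuous phi}.
    by have [d1 _] := dphi _ Ay; apply: differentiable_continuous; apply/derivable1_diffP.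
  apply: (@continuousB _ _ _ u (phi \o @sqnorm R n)) => //.
  exact: (continuous_comp (@continuous_sqnorm R n y)).
have [z zA zmin] := @EVT_min_rV _ _ w A (ex_intro _ x Ax) (@compact_annulus R n t t') cw.
rewrite inE in zA.
suff : 0 <= w z.
  move=> wz; rewrite -subr_ge0; apply: le_trans wz _.
  by apply: zmin; rewrite inE.
have /= /andP[tz zt'] : A z := zA.
have [zt|zt] := eqVneq (sqnorm z) t; first by rewrite subr_ge0; apply: bd; left.
have [zt2|zt2] := eqVneq (sqnorm z) t'; first by rewrite subr_ge0; apply: bd; right.
have tz' : t < sqnorm z by rewrite lt_neqAle eq_sym zt.
have zt'' : sqnorm z < t' by rewrite lt_neqAle zt2.
have zz : t < sqnorm z < t' by rewrite tz' zt''.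
exfalso; have := lap z zz; apply/negP; rewrite -leNgt.
(* Split the Laplacian of the barrier into its second derivatives along each
   axis, so that they can be compared one by one. *)
rewrite /laplacian.
have -> : 4 * sqnorm z * phi2 (sqnorm z) + 2 * n%:R * phi1 (sqnorm z) =
   \sum_(i < n) (4 * z 0 i ^+ 2 * phi2 (sqnorm z) + 2 * phi1 (sqnorm z)).
  rewrite big_split/= sumr_const card_ord -mulr_suml -mulr_sumr.
  by congr (_ + _); rewrite -[RHS]mulr_natr; ring.
apply: ler_sum => i _.
pose L (h : R) : 'rV[R]_n := h *: delta_mx 0 i + z.
pose q (h : R) := sqnorm z + 2 * h * z 0 i + h ^+ 2.
have qE h : sqnorm (L h) = q h by exact: sqnorm_line.
have L0 : L 0 = z by rewrite /L scale0r add0r.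
have q0 : q 0 = sqnorm z by rewrite -qE L0.
have dq (h : R) : is_derive h 1 q (2 * z 0 i + 2 * h).
  rewrite /q; apply: is_derive_eq.
  by rewrite /GRing.scale/=; ring.
have [e e0 eP] : exists2 e : R, 0 < e & forall h, `|h| < e -> t < q h < t'.
  have cq : {for (0 : R), continuous q}.
    by have [d1 _] := dq 0; apply: differentiable_continuous; apply/derivable1_diffP.
  have : \forall h \near (0 : R), t < q h < t'.
    have tq : t < q 0 by rewrite q0.
    have qt : q 0 < t' by rewrite q0.
    have H1 : \forall h \near (0 : R), t < q h := cq _ (lt_nbhsr tq).
    have H2 : \forall h \near (0 : R), q h < t' := cq _ (lt_nbhsl qt).
    by near=> h; apply/andP; split; near: h.
  move=> /nbhs_ballP[e /= e0 eP]; exists e => // h he; apply: eP.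
  by rewrite /ball/= sub0r normrN.
have sub h : `|h| < e -> t <= q h <= t'.
  by move=> /eP /andP[a b]; rewrite !ltW.
have e00 : `|(0 : R)| < e by rewrite normr0.
pose g h := u (L h) - phi (q h).
pose d h := partial i u (L h) - phi1 (q h) * (2 * z 0 i + 2 * h).
pose c := partial i (partial i u) z -
  (4 * z 0 i ^+ 2 * phi2 (sqnorm z) + 2 * phi1 (sqnorm z)).
rewrite -subr_ge0 -/c.
apply: (@second_derivative_ge0 _ g d c e e0).
- move=> h he.
  have dphih := dphi _ (sub _ he).
  have [_ /(_ i)[duh _]] : C2_at u (L h) by apply: u2; rewrite qE sub.
  have D1 := is_derive_line duh.
  have D2 : is_derive h 1 (phi \o q) (phi1 (q h) * (2 * z 0 i + 2 * h)).
    exact: is_derive1_comp.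
  exact: (is_deriveB D1 D2).
- have dphih := dphi1 _ (sub _ e00).
  have [_ /(_ i)[_ duh]] : C2_at u (L 0) by apply: u2; rewrite qE sub.
  have D1 := is_derive_line duh.
  have D2 : is_derive (0 : R) 1 (phi1 \o q) (phi2 (q 0) * (2 * z 0 i + 2 * 0)).
    exact: is_derive1_comp.
  have D3 : is_derive (0 : R) 1 (fun h : R => 2 * z 0 i + 2 * h) 2.
    by apply: is_derive_eq; rewrite /GRing.scale/=; ring.
  have D4 := is_deriveB D1 (is_deriveM D2 D3).
  apply: is_derive_eq D4 _.
  rewrite /GRing.scale/= q0 /c -[in RHS]L0 -/(L 0) /partial; congr (_ - _).
  by rewrite L0; ring.
- move=> h he; have := zmin (L h).
  by rewrite /g L0 q0 -qE; apply; rewrite inE /A/= qE sub.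
Unshelve. all: by end_near. Qed.

(** * Barriers and spherical minima *)

Lemma powRD_gt0 (R : realType) (x r s : R) : 0 < x ->
  x `^ (r + s) = x `^ r * x `^ s.
Proof. by move=> x0; rewrite powRD// (gt_eqF x0) implybT. Qed.

(** All barriers of the proof belong to this family.  The power s^(-nu) is
harmonic when n = 2 nu + 2; the Laplacians of s = |x|^2 and of s^2 are 2n and
(8 + 4n) s. *)
Lemma barrier_comparison (R : realType) (n : nat) (u : 'rV[R]_n -> R)
    (nu alpha gamma delta eta t t' : R) :
  n%:R = 2 * nu + 2 -> 0 < t ->
  (forall x, t <= sqnorm x <= t' -> C2_at u x) ->
  (forall x, t < sqnorm x < t' ->
     laplacian u x < 2 * n%:R * delta + (8 + 4 * n%:R) * eta * sqnorm x) ->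
  (forall x, sqnorm x = t \/ sqnorm x = t' ->
     alpha * sqnorm x `^ (- nu) + gamma + delta * sqnorm x + eta * sqnorm x ^+ 2
     <= u x) ->
  forall x, t <= sqnorm x <= t' ->
    alpha * sqnorm x `^ (- nu) + gamma + delta * sqnorm x + eta * sqnorm x ^+ 2
    <= u x.
Proof.
move=> nnu t0 u2 lap bd.
pose phi s := alpha * s `^ (- nu) + gamma + delta * s + eta * s ^+ 2.
pose phi1 s := alpha * (- nu * s `^ (- nu - 1)) + delta + 2 * eta * s.
pose phi2 s := alpha * (- nu * ((- nu - 1) * s `^ (- nu - 1 - 1))) + 2 * eta.
apply: (@radial_comparison _ _ _ phi phi1 phi2) => //.
- move=> s /andP[ts _]; have s0 : 0 < s by lra.
  have D := @is_derive1_powR R (- nu) _ s0.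
  have D1 : is_derive s 1 (fun s : R => gamma + delta * s + eta * s ^+ 2)
      (delta + 2 * eta * s).
    by apply: is_derive_eq; rewrite /GRing.scale/=; ring.
  have -> : phi =
      alpha \*: (@powR R ^~ (- nu)) + (fun s : R => gamma + delta * s + eta * s ^+ 2).
    by apply/funext => z; rewrite /phi !fctE /= -[_ *: _]/(_ * _); ring.
  apply: is_derive_eq (is_deriveD (is_deriveZ alpha D) D1) _.
  by rewrite /phi1 /GRing.scale/=; ring.
- move=> s /andP[ts _]; have s0 : 0 < s by lra.
  have D := @is_derive1_powR R (- nu - 1) _ s0.
  have D1 : is_derive s 1 (fun s : R => delta + 2 * eta * s) (2 * eta).
    by apply: is_derive_eq; rewrite /GRing.scale/=; ring.
  have -> : phi1 =
      (alpha * - nu) \*: (@powR R ^~ (- nu - 1)) + (fun s : R => delta + 2 * eta * s).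
    by apply/funext => z; rewrite /phi1 !fctE /= -[_ *: _]/(_ * _); ring.
  apply: is_derive_eq (is_deriveD (is_deriveZ (alpha * - nu) D) D1) _.
  by rewrite /phi2 /GRing.scale/=; ring.
move=> x xt; apply: lt_le_trans (lap x xt) _.
have /andP[tx _] := xt; have s0 : 0 < sqnorm x by lra.
rewrite /phi1 /phi2 le_eqVlt; apply/orP; left; apply/eqP.
have -> : sqnorm x `^ (- nu - 1) = sqnorm x * sqnorm x `^ (- nu - 1 - 1).
  rewrite -{2}(powRr1 (ltW s0)) -powRD_gt0//.
  by congr (_ `^ _); ring.
by rewrite nnu; ring.
Qed.

Lemma sqnorm_ge0 (R : realType) (n : nat) (x : 'rV[R]_n) : 0 <= sqnorm x.
Proof. by apply: sumr_ge0 => i _; exact: sqr_ge0. Qed.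

(** The minimum is attained because spheres are compact; m is its value as a
function of the squared radius. *)
Lemma sphere_min (R : realType) (n : nat) (u : 'rV[R]_n -> R) (t0 : R) :
  (0 < n)%N -> 0 <= t0 -> (forall x, t0 <= sqnorm x -> {for x, continuous u}) ->
  exists m : R -> R, (forall x, t0 <= sqnorm x -> m (sqnorm x) <= u x) /\
    forall t, t0 <= t -> exists2 x, sqnorm x = t & u x = m t.
Proof.
case: n u => // n u _ t00 cu.
have H t : t0 <= t -> exists x : 'rV[R]_n.+1, sqnorm x = t /\
    forall y, sqnorm y = t -> u x <= u y.
  move=> tt; have t1 : 0 <= t by apply: le_trans tt.
  pose A := [set x : 'rV[R]_n.+1 | t <= sqnorm x <= t].
  have A0 : A !=set0.
    exists (Num.sqrt t *: delta_mx 0 0 + 0); rewrite /A/= sqnorm_line.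
    have -> : sqnorm (0 : 'rV[R]_n.+1) = 0.
      by rewrite /sqnorm big1// => i _; rewrite mxE expr0n.
    by rewrite mxE mulr0 !add0r sqr_sqrtr// lexx.
  have cA : {within A, continuous u}.
    apply: continuous_in_subspaceT => y; rewrite inE => /andP[ty _].
    by apply: cu; apply: le_trans ty.
  have [x + xmin] := @EVT_min_rV _ _ u A A0 (@compact_annulus _ _ t t) cA.
  rewrite inE => xA; exists x; split.
    by apply/eqP; rewrite eq_le andbC.
  by move=> y yt; apply: xmin; rewrite inE /A/= yt lexx.
have /choice[f fP] : forall t, exists x : 'rV[R]_n.+1, t0 <= t -> sqnorm x = t /\
    forall y, sqnorm y = t -> u x <= u y.
  move=> t; case: (leP t0 t) => [/H[x xP]|_]; first by exists x.
  by exists 0.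
exists (u \o f); split => [x xt|t tt]; first by have [_] := fP _ xt; apply.
by have [ft _] := fP _ tt; exists (f t).
Qed.

Lemma powR_large (R : realType) (q A B : R) : 0 < q ->
  exists2 t : R, B <= t & A <= t `^ q.
Proof.
move=> q0; exists (Num.max B ((Num.max A 0) `^ q^-1)).
  by rewrite le_max lexx.
have A0 : 0 <= Num.max A 0 by rewrite le_max lexx orbT.
apply: (@le_trans _ _ (Num.max A 0)); first by rewrite le_max lexx.
rewrite -[leLHS](@powRr1 _ (Num.max A 0))//.
rewrite -(mulVf (lt0r_neq0 q0)) powRrM ge0_ler_powR ?nnegrE ?powR_ge0//.
- exact: ltW.
- by rewrite le_max powR_ge0 orbT.
- by rewrite le_max lexx orbT.
Qed.

(** A power weight varies by a bounded factor over an annulus of fixed ratio; the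
ratio 16 of squared radii is the one of annulus_gain. *)
Lemma powR_comparable (R : realType) (q : R) : exists2 c : R, 0 < c &
  forall t s, 0 < t -> t <= s -> s <= 16 * t -> c * t `^ q <= s `^ q.
Proof.
case: (leP 0 q) => q0.
  exists 1 => // t s t0 ts _.
  by rewrite mul1r ge0_ler_powR// nnegrE; lra.
exists (16 `^ q); first by rewrite powR_gt0.
move=> t s t0 ts st; rewrite -powRM//; last lra.
rewrite -(opprK q) !(powRN _ (- q)) lef_pV2 ?posrE ?powR_gt0//; [|lra..].
by rewrite ge0_ler_powR// ?nnegrE; lra.
Qed.

(** * A growth recursion without positive solutions *)

(** With l = a_k / a_(k+1), the bound l^(1-p) >= 1 + (p-1)(1-l) shows that
a_k^(1-p) - a_(k+1)^(1-p) is at least (p-1) (a_(k+1) - a_k) / a_(k+1)^p, and the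
doubling bound compares a_(k+1)^p with a_k^p.  So the positive sequence
a_k^(1-p) decreases by a fixed multiple of 1/(k+1) at each step, which is
impossible. *)
Lemma harmonic_growth_absurd (R : realType) (a : nat -> R) (p C c : R) :
  1 < p -> 0 < c -> (forall k, 0 < a k) -> (forall k, a k.+1 <= C * a k) ->
  (forall k, a k + c * a k `^ p / k.+1%:R <= a k.+1) -> False.
Proof.
move=> p1 c0 a0 aC ag.
have C0 : 0 < C by have := lt_le_trans (a0 _) (aC 0%N); rewrite pmulr_lgt0.
pose b k := a k `^ (1 - p).
have b0 k : 0 < b k by rewrite powR_gt0.
pose c' := (p - 1) * c * C `^ (- p).
have c'0 : 0 < c' by rewrite !mulr_gt0 ?powR_gt0//; lra.
have step k : c' / k.+1%:R <= b k - b k.+1.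
  pose l := a k / a k.+1.
  have l0 : 0 < l by rewrite divr_gt0.
  have akE : a k = l * a k.+1 by rewrite divfK// gt_eqF.
  have E1 : b k = b k.+1 * l `^ (1 - p).
    by rewrite /b akE powRM ?(ltW l0) ?(ltW (a0 _))// mulrC.
  (* l^(1-p) = exp ((p-1)(- ln l)), with exp y >= 1 + y and - ln l >= 1 - l. *)
  have E2 : 1 + (p - 1) * (1 - l) <= l `^ (1 - p).
    rewrite /powR gt_eqF//; apply: le_trans (expR_ge1Dx _); rewrite lerD2l.
    have := @le_ln1Dx _ (l - 1); rewrite addrCA subrr addr0 => lnl.
    have {}lnl : ln l <= l - 1 by apply: lnl; lra.
    have -> : (1 - p) * ln l = (p - 1) * - ln l by ring.
    by rewrite ler_pM2l; lra.
  have E3 : b k.+1 * ((p - 1) * (1 - l)) <= b k - b k.+1.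
    rewrite E1.
    have -> : b k.+1 * l `^ (1 - p) - b k.+1 = b k.+1 * (l `^ (1 - p) - 1) by ring.
    by rewrite ler_pM2l//; lra.
  apply: le_trans E3.
  have E4 : c * a k `^ p / k.+1%:R <= a k.+1 * (1 - l).
    by rewrite mulrBr mulr1 [X in _ - X]mulrC -akE lerBrDl.
  have E5 : a k.+1 `^ p <= C `^ p * a k `^ p.
    rewrite -powRM ?(ltW C0) ?(ltW (a0 _))//.
    rewrite ge0_ler_powR ?nnegrE ?mulr_ge0 ?(ltW C0) ?(ltW (a0 _))//; lra.
  have bE : b k.+1 = a k.+1 / a k.+1 `^ p.
    by rewrite /b powRD_gt0// powRr1 ?(ltW (a0 _))// powRN.
  have -> : b k.+1 * ((p - 1) * (1 - l)) = (p - 1) / a k.+1 `^ p * (a k.+1 * (1 - l)).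
    by rewrite bE; ring.
  apply: (@le_trans _ _ ((p - 1) / a k.+1 `^ p * (c * a k `^ p / k.+1%:R))); last first.
    by rewrite ler_pM2l// divr_gt0 ?powR_gt0//; lra.
  have -> : (p - 1) / a k.+1 `^ p * (c * a k `^ p / k.+1%:R) =
      (p - 1) * c / k.+1%:R * (a k `^ p / a k.+1 `^ p) by ring.
  have -> : c' / k.+1%:R = (p - 1) * c / k.+1%:R * C `^ (- p) by rewrite /c'; ring.
  rewrite ler_pM2l; last by rewrite !mulr_gt0 ?invr_gt0//; lra.
  by rewrite powRN ler_pdivlMr ?powR_gt0// ler_pdivrMl ?powR_gt0.
have sumle k : c' * series (@harmonic R) k <= b 0%N - b k.
  elim: k => [|k IH]; first by rewrite /series/= big_nil mulr0 subrr.
  rewrite /series/= big_nat_recr//= mulrDr.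
  have := step k; move: IH; rewrite /series/= => H1 H2.
  by apply: le_trans (lerD H1 H2) _; rewrite addrA subrK.
apply: (@dvg_harmonic R); apply: nondecreasing_is_cvgn.
  by apply: nondecreasing_series => k _ _; exact: harmonic_ge0.
exists (b 0%N / c') => _ [k _ <-].
rewrite ler_pdivlMr// mulrC; apply: le_trans (sumle k) _.
by rewrite gerBl ltW.
Qed.

(** * Positive superharmonic functions outside a ball *)

Section superharmonic.
Variables (R : realType) (n : nat) (nu t0 : R) (u : 'rV[R]_n -> R) (m : R -> R).
Hypothesis nnu : n%:R = 2 * nu + 2.
Hypothesis nu0 : 0 < nu.
Hypothesis t00 : 0 < t0.
Hypothesis u2 : forall x, t0 <= sqnorm x -> C2_at u x.
Hypothesis upos : forall x, t0 <= sqnorm x -> 0 < u x.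
Hypothesis usup : forall x, t0 <= sqnorm x -> laplacian u x < 0.
Hypothesis mle : forall x, t0 <= sqnorm x -> m (sqnorm x) <= u x.
Hypothesis matt : forall t, t0 <= t -> exists2 x, sqnorm x = t & u x = m t.

Lemma m_gt0 t : t0 <= t -> 0 < m t.
Proof.
by move=> tt; have [x xt <-] := matt tt; apply: upos; rewrite xt.
Qed.

(** On t <= s <= rho compare u with a (s^(-nu) - rho^(-nu)), a = t^nu m(t), which
is at most m(t) on the inner sphere and vanishes on the outer one; then let rho
grow.  Letting s vary, this says that t^nu m(t) is nondecreasing. *)
Lemma fundamental_lower_bound t x : t0 <= t -> t <= sqnorm x ->
  t `^ nu * m t * sqnorm x `^ (- nu) <= u x.
Proof.
move=> tt tx; have mt := m_gt0 tt.
have t1 : 0 < t by apply: lt_le_trans tt.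
rewrite leNgt; apply/negP; set a := t `^ nu * m t => ux.
have a0 : 0 < a by rewrite mulr_gt0// powR_gt0.
pose d := a * sqnorm x `^ (- nu) - u x.
have d0 : 0 < d by rewrite subr_gt0.
(* The summand 1 makes a rho^(-nu) strictly smaller than the defect d. *)
have [rho xrho rhoP] := powR_large (a / d + 1) (sqnorm x) nu0.
have trho : t <= rho by apply: le_trans xrho.
have rho0 : 0 < rho by apply: lt_le_trans trho.
have H : a * rho `^ (- nu) < d.
  rewrite powRN ltr_pdivrMr ?powR_gt0// mulrC -ltr_pdivrMr//.
  by apply: lt_le_trans rhoP; rewrite ltrDl.
have : a * sqnorm x `^ (- nu) - a * rho `^ (- nu)
    + 0 * sqnorm x + 0 * sqnorm x ^+ 2 <= u x.
  apply: (@barrier_comparison _ _ u nu a (- (a * rho `^ (- nu))) 0 0 t rho nnu t1).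
  - by move=> y /andP[ty _]; apply: u2; apply: le_trans ty.
  - move=> y /andP[ty _]; rewrite !mulr0 mul0r addr0.
    by apply: usup; apply: le_trans (ltW ty).
  - move=> y; rewrite !mul0r !addr0 => -[yt|yr].
      apply: (@le_trans _ _ (m t)); last by rewrite -yt; apply: mle; rewrite yt.
      rewrite yt {1}/a mulrAC -powRD_gt0// subrr powRr0 mul1r.
      by rewrite lerBlDr lerDl mulr_ge0 ?powR_ge0// ltW.
    by rewrite yr subrr; apply/ltW/upos; rewrite yr (le_trans tt).
  - by rewrite tx.
rewrite !mul0r !addr0 => H1; move: H; rewrite /d; lra.
Qed.

(** The minimum cannot grow fast: on t/4 <= s <= 4t the affine barrier that
vanishes at s = t/4 and equals m(4t) at s = 4t is subharmonic, and at s = t it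
equals (t - t/4) / (4t - t/4) = 1/5 of m(4t). *)
Lemma min_doubling t : 4 * t0 <= t -> m (4 * t) <= 5 * m t.
Proof.
have := t00 => t00'.
move=> tt; have [x xt ux] : exists2 x, sqnorm x = t & u x = m t.
  by apply: matt; lra.
rewrite -ux.
have m4 : 0 < m (4 * t) by apply: m_gt0; lra.
(* The slope of the barrier; 15/4 t is the length of the interval [t/4, 4t]. *)
pose b := m (4 * t) / (15 / 4 * t).
have b0 : 0 < b by rewrite divr_gt0//; lra.
have bE : m (4 * t) = b * (15 / 4 * t) by rewrite divfK//; lra.
have : 0 * sqnorm x `^ (- nu) + (- (b * t / 4)) + b * sqnorm x + 0 * sqnorm x ^+ 2 <= u x.
  apply: (@barrier_comparison _ _ u nu 0 (- (b * t / 4)) b 0 (t / 4) (4 * t) nnu).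
  - by lra.
  - by move=> y /andP[ty _]; apply: u2; lra.
  - move=> y /andP[ty _]; rewrite mulr0 mul0r addr0.
    apply: (@lt_le_trans _ _ 0); first by apply: usup; lra.
    by rewrite mulr_ge0 ?(ltW b0)// mulr_ge0.
  - move=> y [yt|yt].
      rewrite yt; apply: (@le_trans _ _ 0); first by lra.
      by apply/ltW/upos; lra.
    rewrite yt; apply: (@le_trans _ _ (m (4 * t))); first by rewrite bE; lra.
    by rewrite -yt; apply: mle; lra.
  - by rewrite xt; apply/andP; split; lra.
rewrite xt bE; lra.
Qed.

(** The lower bound u >= a(t) s^(-nu) makes -Laplacian u at least the constant F
below on the annulus t <= s <= 16t.  One may therefore add to a(t) s^(-nu) the
multiple eta of (s - t)(16t - s), which vanishes on both boundary spheres and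
equals 36 t^2 at s = 4t. *)
Lemma annulus_gain t V : t0 <= t -> 0 < V ->
  (forall x, t <= sqnorm x <= 16 * t -> V * u x <= - laplacian u x) ->
  (t `^ nu * m t) * (1 + 36 * 4 `^ nu / ((128 + 64 * n%:R) * 16 `^ nu) * (t * V))
    <= (4 * t) `^ nu * m (4 * t).
Proof.
have := t00 => t00'; move=> tt V0 VP; have t1 : 0 < t by apply: lt_le_trans tt.
set a := t `^ nu * m t.
have a0 : 0 < a by rewrite mulr_gt0 ?m_gt0 ?powR_gt0.
have n0 : 0 <= n%:R :> R by [].
pose F := V * (a * (16 * t) `^ (- nu)).
have F0 : 0 < F by rewrite mulr_gt0// mulr_gt0// powR_gt0//; lra.
(* The denominator exceeds the maximum (128 + 30 n) t of minus the Laplacian of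
   (s - t)(16t - s), which is attained at s = 16t. *)
pose eta := F / ((128 + 64 * n%:R) * t).
have k0 : 0 < 128 + 64 * n%:R :> R by lra.
have eta0 : 0 < eta by rewrite divr_gt0// mulr_gt0.
have FE : F = eta * ((128 + 64 * n%:R) * t).
  by rewrite divfK// gt_eqF// mulr_gt0.
have Fle y : t <= sqnorm y <= 16 * t -> F <= - laplacian u y.
  move=> ty; apply: le_trans (VP _ ty); rewrite /F ler_pM2l//.
  have /andP[ty1 ty2] := ty.
  apply: le_trans (fundamental_lower_bound tt ty1); rewrite -/a ler_pM2l//.
  rewrite !powRN lef_pV2 ?posrE ?powR_gt0//; [|lra|lra].
  by rewrite ge0_ler_powR// ?nnegrE ?(ltW nu0)//; lra.
have [x xt ux] : exists2 x, sqnorm x = 4 * t & u x = m (4 * t).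
  by apply: matt; lra.
have : a * sqnorm x `^ (- nu) + (- (16 * eta * t ^+ 2)) + 17 * eta * t * sqnorm x
    + (- eta) * sqnorm x ^+ 2 <= u x.
  apply: (@barrier_comparison _ _ u nu a (- (16 * eta * t ^+ 2))
            (17 * eta * t) (- eta) t (16 * t) nnu t1).
  - by move=> y /andP[ty _]; apply: u2; apply: le_trans ty.
  - move=> y /andP[ty1 ty2].
    have Fy : F <= - laplacian u y by apply: Fle; rewrite !ltW.
    rewrite FE in Fy.
    apply: (@le_lt_trans _ _ (- (eta * ((128 + 64 * n%:R) * t)))); first by lra.
    rewrite -subr_gt0.
    have -> : 2 * n%:R * (17 * eta * t) + (8 + 4 * n%:R) * - eta * sqnorm y -
      - (eta * ((128 + 64 * n%:R) * t)) =
      eta * ((8 + 4 * n%:R) * (16 * t - sqnorm y) + 34 * n%:R * t) by ring.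
    rewrite mulr_gt0// ltr_pwDl//; last by rewrite !mulr_ge0// ltW.
    by rewrite mulr_gt0//; lra.
  - move=> y yb.
    have ty : t <= sqnorm y by case: yb => ->; lra.
    apply: le_trans (fundamental_lower_bound tt ty); rewrite -/a.
    by case: yb => ->; lra.
  - by rewrite xt; apply/andP; split; lra.
rewrite ux xt => H.
have p0 : 0 < (4 * t) `^ nu by rewrite powR_gt0//; lra.
apply: (@le_trans _ _ ((4 * t) `^ nu * (a * (4 * t) `^ (- nu) + 36 * eta * t ^+ 2))); last first.
  by rewrite ler_pM2l//; apply: le_trans H; lra.
rewrite [leRHS]mulrDr [X in _ <= X + _]mulrCA -powRD_gt0; last by lra.
rewrite subrr powRr0 mulr1 [leLHS]mulrDr mulr1 lerD2l le_eqVlt; apply/orP; left; apply/eqP.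
rewrite /eta /F powRN !powRM; [|lra..].
field.
by rewrite !gt_eqF// ?powR_gt0//; lra.
Qed.

(** By annulus_gain and min_doubling the product of t with the weight at
scale t is bounded, whereas t^(theta + 1) is not. *)
Lemma no_linear_supersolution kappa theta : 0 < kappa -> -1 < theta ->
  (forall x, t0 <= sqnorm x ->
     kappa * sqnorm x `^ theta * u x <= - laplacian u x) -> False.
Proof.
move=> k0 th1 lin; have := t00 => t00'.
have [c c0 cP] := powR_comparable theta.
pose K : R := 36 * 4 `^ nu / ((128 + 64 * n%:R) * 16 `^ nu).
have n0 : 0 <= n%:R :> R by [].
have K0 : 0 < K.
  rewrite divr_gt0// mulr_gt0 ?powR_gt0//; lra.
have th0 : 0 < theta + 1 by lra.
have [t tt tP] := powR_large ((5 * 4 `^ nu) / (K * kappa * c)) (4 * t0) th0.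
have t1 : 0 < t by lra.
have tt0 : t0 <= t by lra.
pose V := kappa * (c * t `^ theta).
have V0 : 0 < V by rewrite !mulr_gt0// powR_gt0.
have VP x : t <= sqnorm x <= 16 * t -> V * u x <= - laplacian u x.
  move=> /andP[tx xt]; apply: le_trans (lin x _); last by apply: le_trans tx.
  rewrite ler_wpM2r//; first by apply/ltW/upos/(le_trans tt0).
  by rewrite /V ler_pM2l//; apply: cP; rewrite ?t1 ?tx.
have := annulus_gain tt0 V0 VP; rewrite -/K => H.
have m4 := min_doubling tt.
have a0 : 0 < t `^ nu * m t by rewrite mulr_gt0 ?m_gt0 ?powR_gt0.
have : t `^ nu * m t * (1 + K * (t * V)) <= t `^ nu * m t * (5 * 4 `^ nu).
  apply: le_trans H _; rewrite powRM; [|lra..].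
  have -> : t `^ nu * m t * (5 * 4 `^ nu) = 4 `^ nu * t `^ nu * (5 * m t) by ring.
  by rewrite ler_pM2l// mulr_gt0// powR_gt0.
rewrite ler_pM2l// => H2.
move: tP; rewrite ler_pdivrMr ?mulr_gt0// powRD_gt0// (powRr1 (ltW t1)) => tP.
have E : K * (t * V) = t `^ theta * t * (K * kappa * c) by rewrite /V; ring.
by rewrite -E in tP; lra.
Qed.

(** The exponent is the scale-invariant one: bounding u^(p-1) below by
(a(t) s^(-nu))^(p-1) turns the weight into a(t)^(p-1) / (s ln s), so that the
gain over one annulus is a(t)^p / ln t up to a constant.  On the geometric
scales 4 t0 4^k the logarithm is of order k + 1. *)
Lemma no_superlinear_supersolution kappa p : 0 < kappa -> 1 < p -> 1 < t0 ->
  (forall x, t0 <= sqnorm x ->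
     kappa * sqnorm x `^ (nu * (p - 1) - 1) / ln (sqnorm x) * u x `^ p
       <= - laplacian u x) -> False.
Proof.
move=> k0 p1 t01 sup; have := t00 => t00'.
pose K : R := 36 * 4 `^ nu / ((128 + 64 * n%:R) * 16 `^ nu).
have n0 : 0 <= n%:R :> R by [].
have K0 : 0 < K.
  rewrite divr_gt0// mulr_gt0 ?powR_gt0//; lra.
pose a t := t `^ nu * m t.
have a_gt0 t : t0 <= t -> 0 < a t.
  by move=> tt; rewrite mulr_gt0 ?m_gt0 ?powR_gt0//; lra.
have gain t : t0 <= t ->
    a t + K * kappa / 16 * a t `^ p / ln (16 * t) <= a (4 * t).
  move=> tt; have t1 : 0 < t by lra.
  have a0 := a_gt0 _ tt.
  have l0 : 0 < ln (16 * t) by apply: ln_gt0; lra.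
  pose V := kappa * a t `^ (p - 1) / (16 * t * ln (16 * t)).
  have V0 : 0 < V.
    by rewrite divr_gt0 ?mulr_gt0 ?powR_gt0//; lra.
  have VP x : t <= sqnorm x <= 16 * t -> V * u x <= - laplacian u x.
    move=> /andP[tx xt]; have t0x : t0 <= sqnorm x by lra.
    have x0 : 0 < sqnorm x by lra.
    have ux := upos t0x.
    apply: le_trans (sup x t0x).
    have -> : u x `^ p = u x `^ (p - 1) * u x.
      by rewrite -{3}(powRr1 (ltW ux)) -powRD_gt0// subrK.
    rewrite mulrA ler_pM2r//.
    have up : a t `^ (p - 1) * sqnorm x `^ (- (nu * (p - 1))) <= u x `^ (p - 1).
      rewrite -mulNr powRrM -powRM ?powR_ge0 ?(ltW a0)//.
      have w0 : 0 <= a t * sqnorm x `^ (- nu) by apply: mulr_ge0; [exact: ltW|exact: powR_ge0].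
      apply: ge0_ler_powR; rewrite ?nnegrE//; [lra|exact: ltW|].
      exact: fundamental_lower_bound.
    have lx : 0 < ln (sqnorm x) by apply: ln_gt0; lra.
    apply: (@le_trans _ _ (kappa * sqnorm x `^ (nu * (p - 1) - 1) / ln (sqnorm x) *
       (a t `^ (p - 1) * sqnorm x `^ (- (nu * (p - 1)))))); last first.
      by rewrite ler_pM2l// !mulr_gt0 ?invr_gt0 ?powR_gt0.
    have -> : kappa * sqnorm x `^ (nu * (p - 1) - 1) / ln (sqnorm x) *
       (a t `^ (p - 1) * sqnorm x `^ (- (nu * (p - 1)))) =
       kappa * a t `^ (p - 1) *
       (sqnorm x `^ (nu * (p - 1) - 1) * sqnorm x `^ (- (nu * (p - 1)))) / ln (sqnorm x) by ring.
    rewrite -powRD_gt0// addrAC subrr sub0r powR_inv1 ?(ltW x0)//.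
    rewrite /V -[leRHS]mulrA -invfM ler_pM2l ?mulr_gt0 ?powR_gt0//.
    rewrite lef_pV2 ?posrE ?mulr_gt0//.
    rewrite ler_pM// ?(ltW lx) ?(ltW x0)//.
    by rewrite ler_ln// posrE; lra.
  have := annulus_gain tt V0 VP; rewrite -/K -/(a t) -/(a (4 * t)).
  apply: le_trans; rewrite le_eqVlt; apply/orP; left; apply/eqP.
  have -> : a t `^ p = a t `^ (p - 1) * a t.
    by rewrite -{3}(powRr1 (ltW a0)) -powRD_gt0// subrK.
  by rewrite /V; field; rewrite !gt_eqF.
(* The factor 4 in front of t0 leaves room for min_doubling at the first scale. *)
pose s k : R := 4 * t0 * 4 ^+ k.
have s_ge k : 4 * t0 <= s k.
  by rewrite /s ler_peMr ?exprn_ege1//; lra.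
have sS k : s k.+1 = 4 * s k by rewrite /s exprS; ring.
pose D := ln (16 * (4 * t0)) + ln 4.
have L1 : 0 < ln (16 * (4 * t0)) by apply: ln_gt0; lra.
have L2 : 0 < ln (4 : R) by apply: ln_gt0; lra.
have lns k : ln (16 * s k) <= D * k.+1%:R.
  rewrite /s mulrA lnM ?posrE ?exprn_gt0//; last lra.
  rewrite lnXn// -[X in _ + X]mulr_natr -(natr1 k) /D.
  have k1 : 0 <= k%:R :> R by [].
  have : 0 <= ln (16 * (4 * t0)) * k%:R by rewrite mulr_ge0// ltW.
  lra.
have D0 : 0 < D by rewrite addr_gt0.
apply: (@harmonic_growth_absurd _ (a \o s) p (5 * 4 `^ nu) (K * kappa / 16 / D)) => //.
- by rewrite !mulr_gt0 ?invr_gt0.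
- by move=> k /=; apply: a_gt0; apply: le_trans (s_ge k); lra.
- move=> k /=; rewrite /a sS powRM//; last by have := s_ge k; lra.
  have H := min_doubling (s_ge k).
  have -> : 5 * 4 `^ nu * (s k `^ nu * m (s k)) = 4 `^ nu * s k `^ nu * (5 * m (s k)) by ring.
  by rewrite ler_pM2l// mulr_gt0 ?powR_gt0//; have := s_ge k; lra.
- move=> k /=; rewrite sS.
  have tk : t0 <= s k by apply: le_trans (s_ge k); lra.
  apply: le_trans (gain _ tk); rewrite lerD2l.
  have -> : K * kappa / 16 / D * a (s k) `^ p / k.+1%:R =
      K * kappa / 16 * a (s k) `^ p / (D * k.+1%:R).
    by field; rewrite (gt_eqF D0) andbT nat1r pnatr_eq0.
  rewrite ler_pM2l; last by rewrite !mulr_gt0 ?powR_gt0 ?a_gt0.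
  rewrite lef_pV2 ?posrE//; first by rewrite mulr_gt0.
  by apply: ln_gt0; have := s_ge k; lra.
Qed.

End superharmonic.

(** * Power-logarithm weights *)

(** With M = |tau| + 1, the logarithm of r^eps (ln r)^tau is at least
eps ln r - M ln ln r, and ln y <= y - 1 at y = (eps / M) ln r bounds this below
by M (1 + ln (eps / M)). *)
Lemma power_beats_log (R : realType) (eps tau : R) : 0 < eps ->
  exists2 kappa : R, 0 < kappa &
    forall r, expR 1 <= r -> kappa <= r `^ eps * ln r `^ tau.
Proof.
move=> e0; pose M := `|tau| + 1.
have M0 : 0 < M by rewrite ltr_wpDl.
have q0 : 0 < eps / M by rewrite divr_gt0.
exists (expR (M * (1 + ln (eps / M)))); first exact: expR_gt0.
move=> r er; have r0 : 0 < r by apply: lt_le_trans er; exact: expR_gt0.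
have L1 : 1 <= ln r by rewrite -[leLHS]expRK ler_ln ?posrE ?expR_gt0.
have L0 : 0 < ln r by lra.
rewrite /powR !gt_eqF// -expRD ler_expR.
have l0 : 0 <= ln (ln r) by exact: ln_ge0.
have H : ln (eps / M) + ln (ln r) <= eps / M * ln r - 1.
  rewrite -lnM ?posrE//.
  have := @le_ln1Dx _ (eps / M * ln r - 1); rewrite addrCA subrr addr0; apply.
  by rewrite ltrBrDl addrN mulr_gt0.
have tM : - (M * ln (ln r)) <= tau * ln (ln r).
  rewrite -mulNr ler_wpM2r// lerNl (le_trans _ (_ : `|tau| <= M))// /M ?lerDl//.
  by rewrite -normrN ler_norm.
have := ler_wpM2l (ltW M0) H.
have -> : M * (eps / M * ln r - 1) = eps * ln r - M by field; rewrite gt_eqF.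
rewrite mulrDr => H2; lra.
Qed.

Section exterior.
Variables (R : realType) (N : nat) (u : 'rV[R]_N -> R).
Hypothesis hN : (3 <= N)%N.
Let nu : R := (N%:R - 2) / 2.
Let e : R := expR 1.
Hypothesis u2 : forall x, e <= enorm x -> C2_at u x.
Hypothesis upos : forall x, e <= enorm x -> 0 < u x.

Let nnu : N%:R = 2 * nu + 2. Proof. by rewrite /nu; field. Qed.
Let nu0 : 0 < nu.
Proof.
have : 3 <= N%:R :> R by rewrite (ler_nat _ 3).
by rewrite /nu; lra.
Qed.
Let e0 : 0 < e. Proof. exact: expR_gt0. Qed.

Let enorm_ge (x : 'rV[R]_N) : e ^+ 2 <= sqnorm x -> e <= enorm x.
Proof.
move=> ex; rewrite -(sqr_sqrtr (sqnorm_ge0 x)) in ex.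
by rewrite -ler_sqr ?nnegrE ?sqrtr_ge0 ?(ltW e0).
Qed.

Let powR_sqnorm (x : 'rV[R]_N) q : sqnorm x `^ q = enorm x `^ (2 * q).
Proof.
rewrite powRrM powR_mulrn ?sqrtr_ge0// sqr_sqrtr//; exact: sqnorm_ge0.
Qed.

Let enorm_gt0 (x : 'rV[R]_N) : e <= enorm x -> 0 < enorm x.
Proof. exact: lt_le_trans. Qed.

Let ln_enorm_ge1 (x : 'rV[R]_N) : e <= enorm x -> 1 <= ln (enorm x).
Proof.
by move=> ex; rewrite -[leLHS]expRK ler_ln ?posrE// enorm_gt0.
Qed.

(** Half of the margin beta + 2 > 0 is spent on absorbing the logarithm, the other
half leaves a power s^theta with theta = (beta - 2)/4 > -1. *)
Lemma no_weighted_linear (beta tau C : R) : - 2 < beta -> 0 < C ->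
  (forall x, e <= enorm x ->
    C * (enorm x `^ beta * ln (enorm x) `^ tau) * u x <= - laplacian u x) -> False.
Proof.
move=> hb C0 sup.
have [m [mle matt]] := @sphere_min R N u (e ^+ 2) (ltnW (ltnW hN)) (sqr_ge0 e)
  (fun x ex => (u2 (enorm_ge ex)).1).
have eps0 : 0 < (beta + 2) / 2 by lra.
have [k k0 kP] := power_beats_log tau eps0.
apply: (@no_linear_supersolution R N nu (e ^+ 2) u m nnu nu0 _ _ _ _ mle matt
  (C * k) ((beta - 2) / 4)).
- by rewrite exprn_gt0.
- by move=> x /enorm_ge; exact: u2.
- by move=> x /enorm_ge; exact: upos.
- move=> x /enorm_ge ex; rewrite -oppr_gt0; apply: lt_le_trans (sup x ex).
  rewrite !mulr_gt0 ?powR_gt0 ?upos ?enorm_gt0//.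
  by have := ln_enorm_ge1 ex; lra.
- by rewrite mulr_gt0.
- by lra.
move=> x /enorm_ge ex; apply: le_trans (sup x ex).
rewrite ler_pM2r ?upos// -mulrA ler_pM2l// powR_sqnorm.
(* The exponent -2 < (beta - 2) / 2 < beta is the midpoint between -2 and beta. *)
have -> : enorm x `^ beta =
    enorm x `^ ((beta + 2) / 2) * enorm x `^ (2 * ((beta - 2) / 4)).
  by rewrite -powRD_gt0 ?enorm_gt0//; congr (_ `^ _); field.
rewrite mulrAC.
by rewrite ler_pM2r ?powR_gt0 ?enorm_gt0// kP.
Qed.

(** The power theta of |x| is the scale-invariant one; p <= pstar means
beta >= theta.  A strict inequality leaves a positive power of |x| against
(ln|x|)^(tau + 1); in the critical case tau + 1 > 0 makes that factor at least
1. *)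
Lemma no_weighted_superlinear (beta tau p : R) :
  1 < p -> p < pstar N beta \/ p = pstar N beta /\ -1 < tau ->
  (forall x, e <= enorm x ->
    enorm x `^ beta * ln (enorm x) `^ tau * u x `^ p <= - laplacian u x) -> False.
Proof.
move=> p1 hp sup.
have [m [mle matt]] := @sphere_min R N u (e ^+ 2) (ltnW (ltnW hN)) (sqr_ge0 e)
  (fun x ex => (u2 (enorm_ge ex)).1).
pose theta := 2 * (nu * (p - 1) - 1).
have N2 : 0 < N%:R - 2 :> R by have := nu0; rewrite /nu; lra.
have thE : theta = (N%:R - 2) * p - N%:R by rewrite /theta /nu; field.
have [k k0 kP] : exists2 k : R, 0 < k & forall r, expR 1 <= r ->
    k <= r `^ (beta - theta) * ln r `^ (tau + 1).
  case: hp => [plt|[pE tau1]].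
    apply: power_beats_log; rewrite thE.
    by move: plt; rewrite /pstar ltr_pdivlMr// mulrC; lra.
  exists 1 => // r er; have -> : beta - theta = 0.
    by rewrite thE pE /pstar; field; rewrite gt_eqF.
  have L1 : 1 <= ln r.
    rewrite -[leLHS]expRK ler_ln ?posrE ?expR_gt0//.
    by apply: lt_le_trans er; exact: expR_gt0.
  have : 1 `^ (tau + 1) <= ln r `^ (tau + 1).
    by apply: ge0_ler_powR; rewrite ?nnegrE//; lra.
  by rewrite powR1 powRr0 mul1r.
apply: (@no_superlinear_supersolution R N nu (e ^+ 2) u m nnu nu0 _ _ _ _ mle matt
  (2 * k) p) => //.
- by rewrite exprn_gt0.
- by move=> x /enorm_ge; exact: u2.
- by move=> x /enorm_ge; exact: upos.
- move=> x /enorm_ge ex; rewrite -oppr_gt0; apply: lt_le_trans (sup x ex).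
  rewrite !mulr_gt0 ?powR_gt0 ?upos ?enorm_gt0//.
  by have := ln_enorm_ge1 ex; lra.
- by rewrite mulr_gt0.
- by rewrite exprn_egt1// expR_gt1.
move=> x /enorm_ge ex; apply: le_trans (sup x ex).
have r0 := enorm_gt0 ex; have L1 := ln_enorm_ge1 ex.
have L0 : 0 < ln (enorm x) by lra.
rewrite ler_pM2r ?powR_gt0 ?upos// powR_sqnorm -/theta.
have -> : ln (sqnorm x) = 2 * ln (enorm x).
  by rewrite -(sqr_sqrtr (sqnorm_ge0 x)) lnXn// mulr_natl.
have -> : 2 * k * enorm x `^ theta / (2 * ln (enorm x)) = k * (enorm x `^ theta / ln (enorm x)).
  by field; rewrite gt_eqF.
have -> : enorm x `^ beta * ln (enorm x) `^ tau =
   enorm x `^ (beta - theta) * ln (enorm x) `^ (tau + 1) * (enorm x `^ theta / ln (enorm x)).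
  have -> : enorm x `^ beta = enorm x `^ (beta - theta) * enorm x `^ theta.
    by rewrite -powRD_gt0// subrK.
  rewrite (powRD_gt0 tau 1 L0) (powRr1 (ltW L0)).
  by field; rewrite gt_eqF.
by rewrite ler_pM2r ?kP// divr_gt0 ?powR_gt0.
Qed.

End exterior.

(** * Nonexistence *)

Unset Implicit Arguments.

Theorem proposition4p1 (R : realType) (N : nat) (beta tau p : R)
    (Omega : set 'rV[R]_N) (h : 'rV[R]_N -> R -> R)
    (hN : (3 <= N)%N) (hbeta : - 2 < beta)
    (hOmega : punctured_or_exterior Omega)
    (hext : ~` eball0 (expR 1) `<=` Omega)
    (hmeas : measurable_nonlinearity Omega h)
    (hh : forall (x : 'rV[R]_N) (s : R), ~ eball0 (expR 1) x -> 0 < s ->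
       h x s = enorm x `^ beta * ln (enorm x) `^ tau * s `^ p) :
  ((1 <= p /\ p < pstar N beta) \/ (p = pstar N beta /\ -1 < tau) ->
     ~ exists u : 'rV[R]_N -> R, positive_supersolution Omega h u) /\
  (p < 1 ->
     ~ exists u : 'rV[R]_N -> R, positive_bounded_supersolution Omega h u).
Proof.
have out (x : 'rV[R]_N) : expR 1 <= enorm x -> ~ eball0 (expR 1) x.
  by move=> ex; apply/negP; rewrite -leNgt.
have outO x : expR 1 <= enorm x -> Omega x by move=> /out; exact: hext.
have C2 u : Ck 2 Omega u -> forall x, expR 1 <= enorm x -> C2_at u x.
  move=> [cu du] x /outO Ox; split; first exact: cu.
  move=> i; have [dui [_ ddu]] := du i.
  by split; [exact: dui|have [dd _] := ddu i; exact: dd].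
have sup u : positive_supersolution Omega h u -> forall x, expR 1 <= enorm x ->
    enorm x `^ beta * ln (enorm x) `^ tau * u x `^ p <= - laplacian u x.
  by move=> [_ uP] x ex; have [ux] := uP x (outO x ex); rewrite hh//; exact: out.
have pos u : positive_supersolution Omega h u -> forall x, expR 1 <= enorm x -> 0 < u x.
  by move=> [_ uP] x ex; have [] := uP x (outO x ex).
have ps1 : 1 < pstar N beta.
  have : 3 <= N%:R :> R by rewrite (ler_nat _ 3).
  by move=> N3; rewrite /pstar ltr_pdivlMr; lra.
split.
  move=> hp [u us]; have uC2 := C2 u us.1.
  have [p1|p1] := eqVneq p 1.
    apply: (@no_weighted_linear R N u hN uC2 (pos u us) beta tau 1) => // x ex.
    rewrite mul1r -[X in _ * X <= _](powRr1 (ltW (pos u us x ex))) -p1.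
    exact: sup.
  apply: (@no_weighted_superlinear R N u hN uC2 (pos u us) beta tau p).
  - by case: hp => [[p1' _]|[-> _]]//; rewrite lt_neqAle eq_sym p1.
  - by case: hp => [[_]|]; [left|right].
  - exact: sup.
move=> p1 [u [us ub]]; have uC2 := C2 u us.1.
have [M M0 uM] : exists2 M : R, 0 < M & forall x, Omega x -> u x <= M.
  have [M [_ MP]] := ub; exists (`|M| + 1); first by rewrite ltr_wpDl.
  move=> x Ox; apply: le_trans (ler_norm _) _.
  by apply: MP => //; rewrite (le_lt_trans (ler_norm M))// ltrDl.
(* Since u <= M and p - 1 < 0, u^p = u^(p-1) u >= M^(p-1) u. *)
have MM : 0 < M `^ (p - 1) by rewrite powR_gt0.
apply: (@no_weighted_linear R N u hN uC2 (pos u us) beta tau (M `^ (p - 1)) hbeta MM).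
move=> x ex; apply: le_trans (sup u us x ex).
have ux := pos u us x ex.
have -> : u x `^ p = u x `^ (p - 1) * u x.
  by rewrite -{3}(powRr1 (ltW ux)) -powRD_gt0// subrK.
rewrite [leRHS]mulrA ler_pM2r// [leLHS]mulrC ler_wpM2l ?mulr_ge0 ?powR_ge0//.
rewrite -(opprB 1 p) !(powRN _ (1 - p)) lef_pV2 ?posrE ?powR_gt0//.
rewrite ge0_ler_powR ?nnegrE ?(ltW ux) ?(ltW M0)//; first lra.
exact/uM/outO.
Qed.
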